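(* Let $A$ and $B$ be two nonzero $0,1$-matrices. Then $\mathrm{R}_{\mathbb{B}}(A\otimes B)\ge \mu(A)\cdot\mathrm{R}_{\mathbb{B}}(B)$.
   Context: The Boolean rank $\mathrm{R}_{\mathbb{B}}(A)$ of a $0,1$-matrix $A$ is the smallest number of all-ones combinatorial rectangles needed to cover all $1$-entries of $A$; a combinatorial rectangle is a set $X\times Y$ with $X$ a set of row indices and $Y$ a set of column indices, and it is monochromatic (all-ones) if all entries of $A$ in it equal $1$. For a nonzero $0,1$-matrix $A$, $\mu(A)$ is the number of $1$-entries of $A$ divided by the largest number of $1$-entries in a monochromatic all-ones combinatorial rectangle of $A$. The Kronecker product $A\otimes B$ is the block matrix whose $(i,j)$-th block is $A_{i,j}\cdot B$. *)

(* Defs.v *)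
From mathcomp Require Import all_boot all_order all_algebra.
From mathcomp Require Export mxtens.

Set Implicit Arguments.
Unset Strict Implicit.
Unset Printing Implicit Defensive.

Import Order.TTheory GRing.Theory Num.Theory.
Local Open Scope ring_scope.

Section Matrix01.

Variables m n : nat.
Implicit Types (A : 'M[int]_(m, n)) (C : {set 'I_m * 'I_n}).
Implicit Type S : {set {set 'I_m * 'I_n}}.

Definition zero_one_mx A := forall i j, A i j = 0 \/ A i j = 1.

Definition ones A := [set ij | A ij.1 ij.2 == 1].

Definition rectangle C :=
  [exists X : {set 'I_m}, exists Y : {set 'I_n}, C == setX X Y].

Definition ones_rectangle A C := rectangle C && (C \subset ones A).

Definition ones_rectangle_cover A S :=
  [forall C in S, ones_rectangle A C] && (ones A \subset cover S).

Lemma ex_ones_rectangle_cover A :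
  exists k, [exists S, ones_rectangle_cover A S && (#|S| == k)].
Proof.
exists #|[set [set ij] | ij in ones A]|; apply/existsP.
exists [set [set ij] | ij in ones A]; rewrite eqxx andbT; apply/andP; split.
  apply/forall_inP=> _ /imsetP[[i j] Aij ->]; rewrite /ones_rectangle sub1set Aij.
  rewrite andbT; apply/existsP; exists [set i]; apply/existsP; exists [set j].
  by apply/eqP/setP=> -[i' j']; rewrite in_setX !inE xpair_eqE.
apply/subsetP=> ij Aij; apply/bigcupP; exists [set ij]; last exact: set11.
exact: imset_f.
Qed.

Definition boolean_rank A : nat := ex_minn (ex_ones_rectangle_cover A).

(* An all-ones rectangle C contains exactly #|C| 1-entries. The maximum is
   positive when A has a 1-entry; otherwise the value is 0 / 0 = 0. *)
Definition mu A : rat :=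
  #|ones A|%:R / (\max_(C | ones_rectangle A C) #|C|)%:R.

End Matrix01.

(* Main.v *)
Require Import Defs.
From mathcomp Require Import all_boot all_order all_algebra.
From mathcomp Require Import mxtens.

Set Implicit Arguments.
Unset Strict Implicit.
Unset Printing Implicit Defensive.

Import Order.TTheory GRing.Theory Num.Theory.
Local Open Scope ring_scope.

(** Fix an optimal cover S of the ones of A *t B. For every 1-entry (i, j) of
    A, the block (i, j) of A *t B is a copy of B, so the members of S that meet
    this block restrict to a cover of B: there are at least R_B(B) of them.
    Conversely the blocks met by one member of S form an all-ones rectangle of
    A. Double counting the pairs (block of a 1-entry, member of S meeting it)
    gives #|ones A| * R_B(B) <= #|S| * (size of the largest rectangle of A). *)

Lemma leq_double_count (T U : finType) (X : {set T}) (Y : {set U})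
    (r : T -> U -> bool) (a b : nat) :
    {in X, forall x, a <= #|[set y in Y | r x y]|}%N ->
    {in Y, forall y, #|[set x in X | r x y]| <= b}%N ->
  (#|X| * a <= #|Y| * b)%N.
Proof.
move=> ge_a le_b; rewrite -!sum_nat_const.
apply: (@leq_trans (\sum_(x in X) \sum_(y in Y) if r x y then 1 else 0)).
  by apply: leq_sum => x Xx; rewrite -big_mkcondr sum1dep_card ge_a.
rewrite exchange_big; apply: leq_sum => y Yy.
by rewrite -big_mkcondr sum1dep_card le_b.
Qed.

Lemma rectangleP (m n : nat) (C : {set 'I_m * 'I_n}) :
  reflect (exists X Y, C = setX X Y) (rectangle C).
Proof.
apply: (iffP existsP) => [[X /existsP[Y /eqP->]]|[X [Y ->]]]; exists X.
  by exists Y.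
by apply/existsP; exists Y.
Qed.

Section RectangleMaps.

Variables m n m' n' : nat.
Implicit Type C : {set 'I_m * 'I_n}.

Lemma rectangle_imset (f : 'I_m -> 'I_m') (g : 'I_n -> 'I_n') C :
  rectangle C -> rectangle [set (f xy.1, g xy.2) | xy in C].
Proof.
case/rectangleP=> X [Y ->]; apply/rectangleP; exists (f @: X), (g @: Y).
apply/setP => -[i j]; rewrite in_setX; apply/imsetP/andP.
  case=> -[x y]; rewrite in_setX => /andP[Xx Yy] [-> ->].
  by split; apply: imset_f.
case=> /imsetP[x Xx ->] /imsetP[y Yy ->].
by exists (x, y); rewrite ?in_setX ?Xx.
Qed.

Lemma rectangle_preimset (f : 'I_m' -> 'I_m) (g : 'I_n' -> 'I_n) C :
  rectangle C -> rectangle [set kl | (f kl.1, g kl.2) \in C].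
Proof.
case/rectangleP=> X [Y ->]; apply/rectangleP; exists (f @^-1: X), (g @^-1: Y).
by apply/setP => -[k l]; rewrite in_setX !inE.
Qed.

End RectangleMaps.

Section BooleanRank.

Variables (m n : nat) (A : 'M[int]_(m, n)).

Lemma boolean_rank_le_card S :
  ones_rectangle_cover A S -> (boolean_rank A <= #|S|)%N.
Proof.
rewrite /boolean_rank => covS; case: ex_minnP => k _; apply.
by apply/existsP; exists S; rewrite covS eqxx.
Qed.

Lemma boolean_rank_attained :
  exists2 S, ones_rectangle_cover A S & #|S| = boolean_rank A.
Proof.
rewrite /boolean_rank; case: ex_minnP => k /existsP[S /andP[covS /eqP cardS]] _.
by exists S.
Qed.

End BooleanRank.

Section Blocks.

Variables m n p q : nat.
Implicit Types (C : {set 'I_(m * p) * 'I_(n * q)}) (ij : 'I_m * 'I_n).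
Implicit Types (kl : 'I_p * 'I_q) (xy : 'I_(m * p) * 'I_(n * q)).

Definition block_entry ij kl : 'I_(m * p) * 'I_(n * q) :=
  (mxtens_index (ij.1, kl.1), mxtens_index (ij.2, kl.2)).

Definition entry_block xy : 'I_m * 'I_n :=
  ((mxtens_unindex xy.1).1, (mxtens_unindex xy.2).1).

Definition blocks_met C : {set 'I_m * 'I_n} := [set entry_block xy | xy in C].

Definition block_slice ij C : {set 'I_p * 'I_q} :=
  [set kl | block_entry ij kl \in C].

Lemma block_entryK ij kl : entry_block (block_entry ij kl) = ij.
Proof. by rewrite /entry_block !mxtens_indexK -surjective_pairing. Qed.

Lemma block_entry_surj xy : exists ij kl, xy = block_entry ij kl.
Proof.
case: xy => x y.
case: (mxtens_indexP x) => i k; case: (mxtens_indexP y) => j l.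
by exists (i, j), (k, l).
Qed.

Lemma block_entry_met ij kl C : block_entry ij kl \in C -> ij \in blocks_met C.
Proof. by move=> Cij; rewrite -(block_entryK ij kl) imset_f. Qed.

Lemma rectangle_blocks_met C : rectangle C -> rectangle (blocks_met C).
Proof.
exact: (rectangle_imset (fun x => (mxtens_unindex x).1)
                        (fun y => (mxtens_unindex y).1)).
Qed.

Lemma rectangle_block_slice ij C : rectangle C -> rectangle (block_slice ij C).
Proof.
exact: (rectangle_preimset (fun k => mxtens_index (ij.1, k))
                           (fun l => mxtens_index (ij.2, l))).
Qed.

End Blocks.

Section KroneckerOnes.

Variables (m n p q : nat) (A : 'M[int]_(m, n)) (B : 'M[int]_(p, q)).
Hypothesis A01 : zero_one_mx A.
Implicit Type C : {set 'I_(m * p) * 'I_(n * q)}.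

Lemma block_entry_ones ij kl :
  (block_entry ij kl \in ones (A *t B)) = (ij \in ones A) && (kl \in ones B).
Proof.
rewrite !inE tensmxE.
by case: (A01 ij.1 ij.2) => ->; rewrite ?mul0r ?mul1r ?eqxx.
Qed.

Lemma blocks_met_ones_rectangle C :
  ones_rectangle (A *t B) C -> ones_rectangle A (blocks_met C).
Proof.
case/andP=> rectC /subsetP onesC; apply/andP; split.
  exact: rectangle_blocks_met.
apply/subsetP => _ /imsetP[xy /onesC + ->].
have [ij [kl ->]] := block_entry_surj xy.
by rewrite block_entryK block_entry_ones => /andP[].
Qed.

Lemma block_slice_ones_rectangle ij C :
  ones_rectangle (A *t B) C -> ones_rectangle B (block_slice ij C).
Proof.
case/andP=> rectC /subsetP onesC; apply/andP; split.
  exact: rectangle_block_slice.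
apply/subsetP => kl; rewrite inE => /onesC.
by rewrite block_entry_ones => /andP[].
Qed.

Lemma block_slice_cover S ij :
    ones_rectangle_cover (A *t B) S -> ij \in ones A ->
  ones_rectangle_cover B
    (block_slice ij @: [set C in S | ij \in blocks_met C]).
Proof.
case/andP=> /forall_inP rectS /subsetP coverS Aij; apply/andP; split.
  apply/forall_inP => _ /imsetP[C + ->]; rewrite inE => /andP[SC _].
  exact: block_slice_ones_rectangle (rectS C SC).
apply/subsetP => kl Bkl.
have /coverS/bigcupP[C SC Ckl] : block_entry ij kl \in ones (A *t B).
  by rewrite block_entry_ones Aij.
apply/bigcupP; exists (block_slice ij C); last by rewrite inE.
by rewrite imset_f // inE SC (block_entry_met Ckl).
Qed.

Lemma boolean_rank_le_blocks_met S ij :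
    ones_rectangle_cover (A *t B) S -> ij \in ones A ->
  (boolean_rank B <= #|[set C in S | ij \in blocks_met C]|)%N.
Proof.
move=> covS Aij; apply: leq_trans (leq_imset_card (block_slice ij) _).
exact/boolean_rank_le_card/block_slice_cover.
Qed.

Lemma ones_mul_boolean_rank_le :
  (#|ones A| * boolean_rank B <=
   boolean_rank (A *t B) * \max_(C | ones_rectangle A C) #|C|)%N.
Proof.
have [S covS <-] := boolean_rank_attained (A *t B).
apply: (leq_double_count (r := fun ij C => ij \in blocks_met C)).
  by move=> ij; apply: boolean_rank_le_blocks_met.
have /andP[/forall_inP rectS _] := covS; move=> C /rectS rectC.
apply: leq_trans (leq_bigmax_cond _ (blocks_met_ones_rectangle rectC)).
by apply/subset_leq_card/subsetP => ij; rewrite inE => /andP[].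
Qed.

End KroneckerOnes.

Theorem theorem3 (m n p q : nat) (A : 'M[int]_(m, n)) (B : 'M[int]_(p, q))
  (hA01 : zero_one_mx A) (hB01 : zero_one_mx B) (hA : A != 0) (hB : B != 0) :
  (boolean_rank (A *t B))%:R >= mu A * (boolean_rank B)%:R.
Proof.
have le_ones := ones_mul_boolean_rank_le B hA01; rewrite /mu.
have [->|max_gt0] := posnP (\max_(C | ones_rectangle A C) #|C|).
  by rewrite invr0 mulr0 mul0r ler0n.
by rewrite mulrAC ler_pdivrMr ?ltr0n // -!natrM ler_nat.
Qed.
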